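(* Let $(M,g,J_1,J_2,J_3)$ be a pseudo-hyper-Kähler manifold with $\dim M=4n\geq 8$, admitting a strongly degenerate homogeneous pseudo-hyper-Kähler structure of linear type. Then $(M,g,J_1,J_2,J_3)$ is flat.
   Context: A pseudo-hyper-Hermitian structure on a pseudo-Riemannian manifold $(M,g)$ is a triple $\{J_1,J_2,J_3\}\subset\mathfrak{so}(TM)$ of skew-symmetric endomorphism fields satisfying $J_1^2=J_2^2=J_3^2=-1$, $J_1J_2=J_3$. $(M,g,J_1,J_2,J_3)$ is pseudo-hyper-Kähler if $J_1,J_2,J_3$ are parallel with respect to the Levi-Civita connection $\nabla$ (so the holonomy group is contained in $Sp(p,q)$). A homogeneous pseudo-hyper-Kähler structure is a $(1,2)$-tensor field $S$ such that $\widetilde\nabla=\nabla-S$ satisfies $\widetilde\nabla g=0$, $\widetilde\nabla R=0$, $\widetilde\nabla S=0$, $\widetilde\nabla J_a=0$ for $a=1,2,3$, where $R$ is the curvature tensor of $\nabla$. It is of linear type if $$S_XY=g(X,Y)\xi-g(Y,\xi)X+\sum_{a=1}^3\left(g(J_aY,\xi)J_aX-g(X,J_aY)J_a\xi\right)$$ for a vector field $\xi$. It is strongly degenerate if $\xi\neq 0$ (nowhere vanishing; on a connected manifold this is equivalent to $\xi\not\equiv0$) is isotropic, i.e. $g(\xi,\xi)=0$. *)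

(* Defs.v *)
From HB Require Import structures.
From mathcomp Require Import all_boot all_order all_algebra.
From mathcomp Require Import all_classical all_reals all_analysis.

Set Implicit Arguments.
Unset Strict Implicit.
Unset Printing Implicit Defensive.

Import Order.TTheory GRing.Theory Num.Theory.
Import numFieldNormedType.Exports.

Local Open Scope classical_set_scope.
Local Open Scope ring_scope.

(* For an open set A, [smooth A f] says that f is C^oo on A. *)
Fixpoint Ck (R : realType) (V W : normedModType R) (k : nat) (A : set V)
    (f : V -> W) : Prop :=
  if k is k'.+1 then
    (forall x, A x -> differentiable f x) /\ forall v, Ck k' A ('D_v f)
  else forall x, A x -> {for x, continuous f}.

Definition smooth (R : realType) (V W : normedModType R) (A : set V)
    (f : V -> W) : Prop :=
  forall k, Ck k A f.

(* A smooth manifold of dimension m: a Hausdorff second countable space with a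
   smooth atlas.  [crd c] is only meaningful on [dom c], and [par c], its
   inverse, only on the open set [crd c @` dom c]. *)
Record manifold (R : realType) (m : nat) := Manifold {
  carrier :> topologicalType;
  carrier_hausdorff : hausdorff_space carrier;
  carrier_second_countable : @second_countable carrier;
  chart : Type;
  dom : chart -> set carrier;
  crd : chart -> carrier -> 'rV[R]_m;
  par : chart -> 'rV[R]_m -> carrier;
  dom_open : forall c, open (dom c);
  dom_cover : forall p, exists c, dom c p;
  crd_open : forall c, open (crd c @` dom c);
  crdK : forall c p, dom c p -> par c (crd c p) = p;
  crd_continuous : forall c p, dom c p -> {for p, continuous (crd c)};
  par_continuous : forall c x, (crd c @` dom c) x -> {for x, continuous (par c)};
  transition_smooth : forall c c',
    smooth (crd c @` (dom c `&` dom c')) (crd c' \o par c) }.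

Arguments chart {R m} M : rename.
Arguments dom {R m M} c : rename.
Arguments crd {R m M} c : rename.
Arguments par {R m M} c : rename.

Section Fields.
Context {R : realType} {m : nat} {M : manifold R m}.
Local Notation V := 'rV[R]_m.

Definition crange (c : chart M) : set V := crd c @` dom c.
Definition overlap (c c' : chart M) : set V := crd c @` (dom c `&` dom c').
Definition transition (c c' : chart M) : V -> V := crd c' \o par c.

(* A tensor field of type (r,s) is given by its expressions in all charts: for
   each chart c and each x in [crange c], a multilinear map on V, the tangent
   space at [par c x] read in the chart c.  The expressions must be smooth in x
   and correspond to each other under the differentials of the transition
   maps. *)

Definition vector_field (xi : chart M -> V -> V) : Prop :=
  [/\ forall c, smooth (crange c) (xi c)
    & forall c c' x, overlap c c' x ->
        'd (transition c c') x (xi c x) = xi c' (transition c c' x)].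

Definition tensor02 (g : chart M -> V -> V -> V -> R) : Prop :=
  [/\ forall c x, crange c x ->
        (forall u, scalar (g c x u)) /\ (forall v, scalar (g c x ^~ v)),
      forall c u v, smooth (crange c) (fun x => g c x u v : R^o)
    & forall c c' x u v, overlap c c' x ->
        let t := transition c c' in
        g c x u v = g c' (t x) ('d t x u) ('d t x v)].

Definition tensor11 (J : chart M -> V -> V -> V) : Prop :=
  [/\ forall c x, crange c x -> linear (J c x),
      forall c u, smooth (crange c) (fun x => J c x u)
    & forall c c' x u, overlap c c' x ->
        let t := transition c c' in
        'd t x (J c x u) = J c' (t x) ('d t x u)].

Definition tensor12 (S : chart M -> V -> V -> V -> V) : Prop :=
  [/\ forall c x, crange c x ->
        (forall u, linear (S c x u)) /\ (forall v, linear (S c x ^~ v)),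
      forall c u v, smooth (crange c) (fun x => S c x u v)
    & forall c c' x u v, overlap c c' x ->
        let t := transition c c' in
        'd t x (S c x u v) = S c' (t x) ('d t x u) ('d t x v)].

(* An affine connection is given in the chart c by its Christoffel map G c,
   that is nabla_X Y = D_X Y + G c (X, Y); the second derivative of the
   transition map in the transformation law expresses that nabla_X Y is a
   vector field. *)
Definition connection (G : chart M -> V -> V -> V -> V) : Prop :=
  [/\ forall c x, crange c x ->
        (forall u, linear (G c x u)) /\ (forall v, linear (G c x ^~ v)),
      forall c u v, smooth (crange c) (fun x => G c x u v)
    & forall c c' x u v, overlap c c' x ->
        let t := transition c c' in
        'd t x (G c x u v) =
          'D_u (fun y => 'd t y v) x + G c' (t x) ('d t x u) ('d t x v)].

End Fields.

(* Calculus in one chart: X, Y, Z, W are vector fields on an open set of V and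
   G is the Christoffel map of a connection. *)
Section LocalCalculus.
Context {R : realType} {m : nat}.
Local Notation V := 'rV[R]_m.
Implicit Types (G : V -> V -> V -> V) (X Y Z W : V -> V).

Definition bracket X Y : V -> V := fun x => 'D_(X x) Y x - 'D_(Y x) X x.

Definition nabla G X Y : V -> V := fun x => 'D_(X x) Y x + G x (X x) (Y x).

Definition torsion G X Y : V -> V :=
  fun x => nabla G X Y x - nabla G Y X x - bracket X Y x.

Definition curvature G X Y Z : V -> V :=
  fun x => nabla G X (nabla G Y Z) x - nabla G Y (nabla G X Z) x
           - nabla G (bracket X Y) Z x.

(* (nabla_X T) evaluated on Y, Z, W, for T of type (0,2), (1,1), (1,2), (1,3). *)

Definition cov02 G (T : V -> V -> V -> R) X Y Z : V -> R :=
  fun x => 'D_(X x) (fun y => T y (Y y) (Z y) : R^o) x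
           - T x (nabla G X Y x) (Z x) - T x (Y x) (nabla G X Z x).

Definition cov11 G (T : V -> V -> V) X Y : V -> V :=
  fun x => nabla G X (fun y => T y (Y y)) x - T x (nabla G X Y x).

Definition cov12 G (T : V -> V -> V -> V) X Y Z : V -> V :=
  fun x => nabla G X (fun y => T y (Y y) (Z y)) x
           - T x (nabla G X Y x) (Z x) - T x (Y x) (nabla G X Z x).

Definition cov13 G (T : V -> V -> V -> V -> V) X Y Z W : V -> V :=
  fun x => nabla G X (fun y => T y (Y y) (Z y) (W y)) x
           - T x (nabla G X Y x) (Z x) (W x) - T x (Y x) (nabla G X Z x) (W x)
           - T x (Y x) (Z x) (nabla G X W x).

End LocalCalculus.

Section Geometry.
Context {R : realType} {m : nat} {M : manifold R m}.
Local Notation V := 'rV[R]_m.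
Implicit Types (G S : chart M -> V -> V -> V -> V)
  (g : chart M -> V -> V -> V -> R) (J : 'I_3 -> chart M -> V -> V -> V)
  (xi : chart M -> V -> V).

(* Torsion, curvature and covariant derivatives are tensorial in the vector
   fields, hence determined by their values on the fields [cst u] with constant
   coordinates. *)

Definition torsion_free G : Prop :=
  forall c x u v, crange c x -> torsion (G c) (cst u) (cst v) x = 0.

Definition curvature_tensor G : chart M -> V -> V -> V -> V -> V :=
  fun c x u v w => curvature (G c) (cst u) (cst v) (cst w) x.

Definition parallel02 G g : Prop :=
  forall c x u v w, crange c x ->
    cov02 (G c) (g c) (cst u) (cst v) (cst w) x = 0.

Definition parallel11 G (T : chart M -> V -> V -> V) : Prop :=
  forall c x u v, crange c x -> cov11 (G c) (T c) (cst u) (cst v) x = 0.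

Definition parallel12 G (T : chart M -> V -> V -> V -> V) : Prop :=
  forall c x u v w, crange c x ->
    cov12 (G c) (T c) (cst u) (cst v) (cst w) x = 0.

Definition parallel13 G (T : chart M -> V -> V -> V -> V -> V) : Prop :=
  forall c x u v w z, crange c x ->
    cov13 (G c) (T c) (cst u) (cst v) (cst w) (cst z) x = 0.

Definition flat G : Prop :=
  forall c x u v w, crange c x -> curvature_tensor G c x u v w = 0.

Definition pseudo_riemannian g : Prop :=
  [/\ tensor02 g,
      forall c x u v, crange c x -> g c x u v = g c x v u
    & forall c x u, crange c x -> (forall v, g c x u v = 0) -> u = 0].

Definition levi_civita g G : Prop :=
  [/\ connection G, torsion_free G & parallel02 G g].

(* J 0, J 1, J 2 stand for J_1, J_2, J_3. *)
Definition pseudo_hyper_hermitian g J : Prop :=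
  [/\ forall a, tensor11 (J a),
      forall a c x u v, crange c x ->
        g c x (J a c x u) v = - g c x u (J a c x v),
      forall a c x u, crange c x -> J a c x (J a c x u) = - u
    & forall c x u, crange c x -> J 0 c x (J 1 c x u) = J 2 c x u].

Definition pseudo_hyper_kahler g G J : Prop :=
  pseudo_hyper_hermitian g J /\ forall a, parallel11 G (J a).

(* Here G is the Levi-Civita connection of g, and nabla - S has Christoffel map
   G c x - S c x. *)
Definition homogeneous_structure g G J S : Prop :=
  tensor12 S /\
  let G' := fun c x u v => G c x u v - S c x u v in
  [/\ parallel02 G' g, parallel13 G' (curvature_tensor G), parallel12 G' S
    & forall a, parallel11 G' (J a)].

Definition linear_type g J S xi : Prop :=
  forall c x u v, crange c x ->
    S c x u v = g c x u v *: xi c x - g c x v (xi c x) *: u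
      + \sum_(a < 3) (g c x (J a c x v) (xi c x) *: J a c x u
                      - g c x u (J a c x v) *: J a c x (xi c x)).

Definition strongly_degenerate g xi : Prop :=
  forall c x, crange c x -> xi c x <> 0 /\ g c x (xi c x) (xi c x) = 0.

End Geometry.

(* Main.v *)
Require Import Defs.
From HB Require Import structures.
From mathcomp Require Import all_boot all_order all_algebra.
From mathcomp Require Import all_classical all_reals all_analysis.
From mathcomp Require Import ring lra.

Set Implicit Arguments.
Unset Strict Implicit.
Unset Printing Implicit Defensive.

Import Order.TTheory GRing.Theory Num.Theory.
Import numFieldNormedType.Exports.

Local Open Scope classical_set_scope.
Local Open Scope ring_scope.

(** Every hypothesis is local, so the argument runs in one chart, with nabla
    and nabla' = nabla - S applied to fields with constant coordinates.  Write
    I, J, K for the three complex structures, C for the curvature, and theta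
    for the 1-form g(., xi).

    The field xi is nabla'-parallel ([xi_parallel]): by the Leibniz rule
    the equation nabla' S = 0 says that the tensor of linear type built from
    nabla'_z xi instead of xi vanishes, and in dimension > 4 such a tensor
    determines its vector ([linear_structure_eq0]).  Hence nabla_z xi = S_z xi,
    and as xi is isotropic this is q(z) xi, where q is the quaternion-valued
    1-form theta - g(., I xi) I - g(., J xi) J - g(., K xi) K ([nabla_xi]).
    The connection form q is flat, so C(u, v) xi = 0 ([curvature_xi]).  By the
    pair symmetry of C, the vectors xi, I xi, J xi, K xi are also annihilated
    in the first two slots of C.

    The equation nabla' C = 0 says that nabla C = S . C.  In the second Bianchi
    identity for S . C everything cancels except
      theta(u) C(v, z) + theta(v) C(z, u) + theta(z) C(u, v) = 0
    ([cyclic_theta]).  Since C(I u, I v) = C(u, v), and likewise for J, the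
    forms g(., I xi) and g(., J xi) satisfy the same identity.  Thus C, as a
    2-form, is divisible by three linearly independent 1-forms, which forces
    C = 0 ([curvature_eq0]).

    The commutation of C with I, J, K and the second Bianchi identity are formal
    consequences of the Ricci identity
    nabla_u nabla_v Y - nabla_v nabla_u Y = C(u, v) Y ([ricci]), which, like the
    skewness of C, rests on the symmetry of second derivatives ([schwarz],
    [schwarz_row]). *)

(** * Symmetry of second derivatives *)

Section Smooth.
Variables (R : realType) (V W : normedModType R) (A : set V) (f : V -> W).
Hypothesis sf : smooth A f.

Lemma smooth_differentiable x : A x -> differentiable f x.
Proof. by case: (sf 1) => + _; exact. Qed.

Lemma smooth_derive v : smooth A ('D_v f).
Proof. by move=> k; case: (sf k.+1) => _; exact. Qed.

Lemma smooth_continuous x : A x -> {for x, continuous f}.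
Proof. exact: (sf 0). Qed.

End Smooth.

Section Schwarz.
Variables (R : realType) (V : normedModType R).

Lemma mvt_line (f : V -> R^o) (x v : V) (h : R) : 0 < h ->
  (forall t, 0 <= t <= h -> differentiable f (x + t *: v)) ->
  exists2 t, 0 < t < h & f (x + h *: v) - f x = h * 'D_v f (x + t *: v).
Proof.
move=> h0 df.
pose F (t : R) : R := f (x + t *: v).
have dF t : 0 <= t <= h -> is_derive t (1 : R) F ('D_v f (x + t *: v)).
  move=> th; have dft := df _ th.
  have dl : is_diff t (cst x + *:%R^~ v) (0 + *:%R^~ v) by exact: is_diffD.
  have dF' : differentiable F t by apply: differentiable_comp.
  apply: DeriveDef; first exact/derivable1_diffP.
  rewrite deriveE// /F -[fun _ => _]/(f \o (cst x + *:%R^~ v)) diff_comp//.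
  by rewrite /= diff_val /= add0r scale1r deriveE.
have [||t] := @MVT R F (fun t => 'D_v f (x + t *: v)) 0 h h0.
- by move=> t; rewrite in_itv/= => /andP[t0 th]; apply: dF; rewrite !ltW.
- apply: continuous_in_subspaceT => t; rewrite inE/= in_itv/= => th.
  by apply: differentiable_continuous; apply/derivable1_diffP; have [] := dF _ th.
rewrite in_itv/= => th; rewrite /F scale0r addr0 subr0 => E.
by exists t => //; rewrite E mulrC.
Qed.

Lemma derive_shiftx (W : normedModType R) (f : V -> W) (a x v : V) :
  'D_v (fun y => f (y + a)) x = 'D_v f (x + a).
Proof. by rewrite /derive/=; under eq_fun do rewrite -addrA. Qed.

(** The mean value theorem along u, applied to f (. + h v) - f, then along v,
    applied to the derivative along u.  The left-hand side is symmetric in u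
    and v, which is what makes mixed derivatives commute. *)
Lemma second_difference (f fu : V -> R^o) (x u v : V) (h : R) : 0 < h ->
  (forall s t, 0 <= s <= h -> 0 <= t <= h ->
    let y := x + s *: u + t *: v in
    [/\ differentiable f y, 'D_u f y = fu y & differentiable fu y]) ->
  exists s t, [/\ 0 < s < h, 0 < t < h &
    f (x + h *: u + h *: v) - f (x + h *: u) - (f (x + h *: v) - f x)
    = h * (h * 'D_v fu (x + s *: u + t *: v))].
Proof.
move=> h0 df; have hh : 0 <= h <= h by rewrite lexx ltW.
have h00 : 0 <= (0 : R) <= h by rewrite lexx ltW.
pose F (y : V) : R^o := f (y + h *: v) - f y.
have dsh (y : V) : differentiable f (y + h *: v) ->
    differentiable (fun y => f (y + h *: v)) y.
  move=> dfy; rewrite -[fun _ => _]/(f \o (fun y => y + h *: v)).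
  by apply: differentiable_comp => //; exact: differentiableD.
have df0 (s : R) : 0 <= s <= h -> differentiable f (x + s *: u).
  by move=> sh; have [] := df s 0 sh h00; rewrite scale0r addr0.
have [|s sh] := @mvt_line F x u h h0.
  move=> s sh; apply: differentiableB; last exact: df0.
  by apply: dsh; have [] := df s h sh hh.
have sh' : 0 <= s <= h by case/andP: sh => s0 s1; rewrite !ltW.
rewrite /F deriveB; first last.
- exact/diff_derivable/df0.
- by apply/diff_derivable/dsh; have [] := df s h sh' hh.
have [_ e1 _] := df s h sh' hh; have [_] := df s 0 sh' h00.
rewrite scale0r addr0 derive_shiftx e1 => -> _ E.
have [|t th E'] := @mvt_line fu (x + s *: u) v h h0.
  by move=> t th; have [] := df s t sh' th.
by exists s, t; split => //; rewrite -E' -E.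
Qed.

(** The functions fu, fv, fuv, fvu represent the derivatives of f on A: in this
    form the lemma applies to the coordinates of a vector-valued map, whose
    derivatives are known on A only, as the coordinates of its derivatives. *)
Lemma schwarz_scalar (A : set V) (f fu fv fuv fvu : V -> R^o) (x u v : V) :
  open A -> A x -> (forall y, A y -> differentiable f y) ->
  (forall y, A y -> [/\ 'D_u f y = fu y, differentiable fu y & 'D_v fu y = fvu y]) ->
  (forall y, A y -> [/\ 'D_v f y = fv y, differentiable fv y & 'D_u fv y = fuv y]) ->
  {for x, continuous fuv} -> {for x, continuous fvu} -> fuv x = fvu x.
Proof.
move=> oA Ax df du dv cuv cvu.
apply/eqP; rewrite -subr_eq0 -normr_eq0 eq_le normr_ge0 andbT.
apply/ler_addgt0Pl => e e0; rewrite addr0.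
have e2 : 0 < e / 2 by rewrite divr_gt0.
have nA : \forall y \near x, [/\ A y,
    `|fuv x - fuv y| < e / 2 & `|fvu x - fvu y| < e / 2].
  near=> y; split.
  - by near: y; exact: open_nbhs_nbhs.
  - by near: y; move/cvgrPdist_lt : cuv; exact.
  - by near: y; move/cvgrPdist_lt : cvu; exact.
have /nbhs_ballP[r/= r0 rA] := nA.
(* The parallelogram with sides h u and h v lies in the ball of radius r. *)
pose k := `|u| + `|v| + 1.
have k0 : 0 < k by rewrite /k -addrA ltr_wpDl// ltr_wpDl.
pose h := r / k.
have h0 : 0 < h by rewrite divr_gt0.
have inA s t : 0 <= s <= h -> 0 <= t <= h -> ball x r (x + s *: u + t *: v).
  move=> /andP[s0 sh] /andP[t0 th]; rewrite -ball_normE/=.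
  rewrite -addrA opprD addNKr normrN.
  apply: le_lt_trans (ler_normD _ _) _; rewrite !normrZ !ger0_norm//.
  have -> : r = h * k by rewrite /h divfK// gt_eqF.
  by rewrite /k mulrDr mulr1 ltr_pwDr// mulrDr lerD// ler_wpM2r.
have [|s [t [sh th E]]] := @second_difference f fu x u v h h0.
  move=> s t sh th /=; have [Ay _ _] := rA _ (inA s t sh th).
  by have [] := du _ Ay; split => //; exact: df.
have [|t' [s' [th' sh' E']]] := @second_difference f fv x v u h h0.
  move=> t' s' th' sh' /=; rewrite addrAC; have [Ay _ _] := rA _ (inA s' t' sh' th').
  by have [] := dv _ Ay; split => //; exact: df.
have /rA[yA _ near1] := inA s t (ltac:(by case/andP: sh => *; rewrite !ltW))
  (ltac:(by case/andP: th => *; rewrite !ltW)).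
have /rA[y'A near2 _] := inA s' t' (ltac:(by case/andP: sh' => *; rewrite !ltW))
  (ltac:(by case/andP: th' => *; rewrite !ltW)).
have hn0 : h != 0 by rewrite gt_eqF.
rewrite [x + t' *: v + _]addrAC in E'.
have EE : fvu (x + s *: u + t *: v) = fuv (x + s' *: u + t' *: v).
  have [_ _ <-] := du _ yA; have [_ _ <-] := dv _ y'A.
  apply: (mulfI hn0); apply: (mulfI hn0); rewrite -E -E' [x + h *: v + _]addrAC.
  by rewrite !opprB addrACA [RHS]addrACA [- _ - _]addrC.
rewrite -EE in near2.
apply: ltW; rewrite (splitr e).
rewrite -(subrKA (fvu (x + s *: u + t *: v))).
by apply: le_lt_trans (ler_normD _ _) _; rewrite ltrD// distrC.
Unshelve. all: by end_near. Qed.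

Lemma schwarz (A : set V) (f : V -> R^o) (x u v : V) :
  open A -> smooth A f -> A x -> 'D_u ('D_v f) x = 'D_v ('D_u f) x.
Proof.
move=> oA sf Ax.
have d (h : V -> R^o) y : smooth A h -> A y -> differentiable h y.
  by move=> /smooth_differentiable; exact.
apply: (@schwarz_scalar A f ('D_u f) ('D_v f)
  ('D_u ('D_v f)) ('D_v ('D_u f)) x u v) => //.
- by move=> y; exact: d.
- by move=> y Ay; split=> //; have /d/(_ Ay) := smooth_derive sf u.
- by move=> y Ay; split=> //; have /d/(_ Ay) := smooth_derive sf v.
- by have /smooth_continuous/(_ x Ax) := smooth_derive (smooth_derive sf v) u.
- by have /smooth_continuous/(_ x Ax) := smooth_derive (smooth_derive sf u) v.
Qed.

Lemma schwarz_row (m : nat) (A : set V) (f : V -> 'rV[R]_m) (x u v : V) :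
  open A -> smooth A f -> A x -> 'D_u ('D_v f) x = 'D_v ('D_u f) x.
Proof.
move=> oA sf Ax.
have dfi (h : V -> 'rV[R]_m) i w y : smooth A h -> A y ->
    differentiable (fun y => h y 0 i : R^o) y /\
    'D_w (fun y => h y 0 i : R^o) y = 'D_w h y 0 i.
  move=> sh Ay; have dh := smooth_differentiable sh Ay; split.
    rewrite -[fun _ => _]/((fun M : 'rV[R]_m => M 0 i : R^o) \o h).
    by apply: differentiable_comp => //; exact: differentiable_coord.
  by rewrite derive_mx ?mxE//; exact/diff_derivable.
have ci (h : V -> 'rV[R]_m) i : smooth A h ->
    {for x, continuous (fun y => h y 0 i : R^o)}.
  by move=> /dfi d; apply: differentiable_continuous; case: (d i 0 x Ax).
have s2 w w' : smooth A ('D_w ('D_w' f)) by do 2!apply: smooth_derive.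
apply/rowP => i.
apply: (@schwarz_scalar A (fun y => f y 0 i) (fun y => 'D_u f y 0 i)
  (fun y => 'D_v f y 0 i) (fun y => 'D_u ('D_v f) y 0 i)
  (fun y => 'D_v ('D_u f) y 0 i) x u v) => //; try exact: ci.
- by move=> y Ay; have [] := dfi f i 0 y sf Ay.
- move=> y Ay; split; first by have [] := dfi f i u y sf Ay.
    by have [] := dfi _ i v y (smooth_derive sf u) Ay.
  by have [] := dfi _ i v y (smooth_derive sf u) Ay.
- move=> y Ay; split; first by have [] := dfi f i v y sf Ay.
    by have [] := dfi _ i u y (smooth_derive sf v) Ay.
  by have [] := dfi _ i u y (smooth_derive sf v) Ay.
Qed.

End Schwarz.

(** * Leibniz rules for fields of linear maps *)

Section Leibniz.
Variables (R : realType).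

Lemma differentiable_scale (V W : normedModType R) (k : V -> R^o) (f : V -> W) x :
  differentiable k x -> differentiable f x ->
  differentiable (fun y => k y *: f y) x /\
  forall z, 'D_z (fun y => k y *: f y) x = 'D_z k x *: f x + k x *: 'D_z f x.
Proof.
move=> dk df.
pose s (a : R^o) (w : W) := a *: w.
have sb : bilinear_for *:%R *:%R s.
  split=> [w a p q|b a p q]; rewrite /s /=; first by rewrite scalerDl scalerA.
  by rewrite scalerDr !scalerA mulrC.
pose B := HB.pack_for {bilinear R^o -> W -> W} s
  (bilinear_isBilinear.Build R R^o W W _ _ _ sb).
have cB : continuous (fun p : R^o * W => B p.1 p.2) by exact: scale_continuous.
have dB := differentiable_bilin (f := B) (k x, f x) cB.
have dp : differentiable (fun y => (k y, f y)) x by exact: differentiable_pair.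
have dkf : differentiable (fun y => k y *: f y) x.
  rewrite -[fun _ => _]/((fun p : R^o * W => B p.1 p.2) \o (fun y => (k y, f y))).
  exact: differentiable_comp.
split=> // z; rewrite deriveE//.
rewrite -[fun _ => _]/((fun p : R^o * W => B p.1 p.2) \o (fun y => (k y, f y))).
by rewrite diff_comp// diff_bilin//= diff_pair//= -!deriveE// addrC.
Qed.

Lemma near_eq_differentiable (V W : normedModType R) (f g : V -> W) x :
  (\forall y \near x, f y = g y) -> differentiable g x -> differentiable f x.
Proof.
move=> fg dg; have [cdg Eg] := (diff_locallyP _ _).1 dg.
have Ef : f \o shift x = cst (f x) + 'd g x +o_ 0 id.
  have fg0 : \forall h \near (0 : V), f (h + x) = g (h + x).
    by move: fg; rewrite (near_shift 0 x) subr0.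
  apply/eqaddoP => e e0; move/eqaddoP/(_ e e0) : Eg.
  by apply: filterS2 fg0 => h /= + H; rewrite !fctE/= (nbhs_singleton fg) => ->.
apply/diff_locallyP; rewrite (diff_unique cdg Ef); split => //.
Qed.

(** Near x, L y (Y y) is the sum of the products of the coordinates of Y y with
    the values of L y on the standard basis. *)
Lemma leibniz1 (m : nat) (W : normedModType R) (A : set 'rV[R]_m)
    (L : 'rV[R]_m -> 'rV[R]_m -> W) (Y : 'rV[R]_m -> 'rV[R]_m) x :
  open A -> A x -> (forall y, A y -> linear (L y)) ->
  (forall e, differentiable (L^~ e) x) -> differentiable Y x ->
  differentiable (fun y => L y (Y y)) x /\
  forall z, 'D_z (fun y => L y (Y y)) x =
    'D_z (fun y => L y (Y x)) x + L x ('D_z Y x).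
Proof.
move=> oA Ax linL dL dY.
have expand y (a : 'rV[R]_m) : A y -> L y a = \sum_i a 0 i *: L y (delta_mx 0 i).
  move=> Ay.
  pose l := HB.pack_for {linear 'rV[R]_m -> W} (L y)
    (GRing.isLinear.Build _ _ _ _ _ (linL y Ay)).
  rewrite -[L y]/(l : _ -> _) {1}(row_sum_delta a) linear_sum.
  by apply: eq_bigr => i _; rewrite linearZ.
have nA : \forall y \near x, A y by exact: open_nbhs_nbhs.
have dYi i : differentiable (fun y => Y y 0 i : R^o) x.
  rewrite -[fun _ => _]/((fun M : 'rV[R]_m => M 0 i : R^o) \o Y).
  by apply: differentiable_comp => //; exact: differentiable_coord.
have DYi z i : 'D_z (fun y => Y y 0 i : R^o) x = 'D_z Y x 0 i.
  by rewrite [in RHS]derive_mx ?mxE//; exact/diff_derivable.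
pose F i y := Y y 0 i *: L y (delta_mx 0 i).
have dF i : differentiable (F i) x := (differentiable_scale (dYi i) (dL _)).1.
have EF : (\forall y \near x, L y (Y y) = (\sum_i F i) y).
  near=> y; rewrite fct_sumE; apply: expand; near: y; exact: nA.
have EL (a : 'rV[R]_m) : \forall y \near x,
    L y a = (\sum_i (fun y => a 0 i *: L y (delta_mx 0 i))) y.
  near=> y; rewrite fct_sumE; apply: expand; near: y; exact: nA.
split=> [|z].
  exact: near_eq_differentiable EF (differentiable_sum dF).
rewrite (near_eq_derive _ EF) (near_eq_derive _ (EL _)) (expand x)//.
pose H (a : 'rV[R]_m) i y := a 0 i *: L y (delta_mx 0 i).
have dH a i : derivable (H a i) x z by exact/diff_derivable/differentiableZ.
rewrite (@derive_sum _ _ _ _ F) => [|i]; last exact/diff_derivable/dF.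
rewrite (@derive_sum _ _ _ _ (H (Y x))) //.
rewrite -big_split/=; apply: eq_bigr => i _.
rewrite (differentiable_scale (dYi i) (dL _)).2 DYi addrC; congr (_ + _).
by rewrite -deriveZ//; exact/diff_derivable.
Unshelve. all: by end_near. Qed.

Lemma leibniz2 (m : nat) (W : normedModType R) (A : set 'rV[R]_m)
    (T : 'rV[R]_m -> 'rV[R]_m -> 'rV[R]_m -> W)
    (Y Z : 'rV[R]_m -> 'rV[R]_m) x :
  open A -> A x ->
  (forall y, A y -> (forall u, linear (T y u)) /\ (forall v, linear (T y ^~ v))) ->
  (forall u v, differentiable (fun y => T y u v) x) ->
  differentiable Y x -> differentiable Z x ->
  differentiable (fun y => T y (Y y) (Z y)) x /\
  forall z, 'D_z (fun y => T y (Y y) (Z y)) x =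
    'D_z (fun y => T y (Y x) (Z x)) x + T x ('D_z Y x) (Z x) + T x (Y x) ('D_z Z x).
Proof.
move=> oA Ax linT dT dY dZ.
have TY e := leibniz1 (L := fun y a => T y a e) oA Ax
  (fun y Ay => (linT y Ay).2 e) (fun u => dT u e) dY.
have [dTYZ DTYZ] := leibniz1 (L := fun y => T y (Y y)) oA Ax
  (fun y Ay => (linT y Ay).1 (Y y)) (fun e => (TY e).1) dZ.
by split=> // z; rewrite DTYZ (TY _).2.
Qed.

End Leibniz.

(** * Hyper-Hermitian linear algebra *)

Lemma linear_mapD (R : pzRingType) (V W : lmodType R) (f : V -> W) :
  linear f -> forall a b, f (a + b) = f a + f b.
Proof. by move=> lf a b; have := lf 1 a b; rewrite !scale1r. Qed.

Lemma linear_map0 (R : pzRingType) (V W : lmodType R) (f : V -> W) :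
  linear f -> f 0 = 0.
Proof.
move=> lf; have := linear_mapD lf 0 0; rewrite addr0 => /eqP.
by rewrite -subr_eq0 opprD addNKr oppr_eq0 => /eqP.
Qed.

Lemma linear_mapZ (R : pzRingType) (V W : lmodType R) (f : V -> W) :
  linear f -> forall k a, f (k *: a) = k *: f a.
Proof. by move=> lf k a; have := lf k a 0; rewrite addr0 (linear_map0 lf) addr0. Qed.

Lemma linear_mapN (R : pzRingType) (V W : lmodType R) (f : V -> W) :
  linear f -> forall a, f (- a) = - f a.
Proof. by move=> lf a; rewrite -scaleN1r (linear_mapZ lf) scaleN1r. Qed.

Section HyperHermitian.
Variables (R : realFieldType) (m : nat).
Local Notation V := 'rV[R]_m.

Record hyper_hermitian (g : V -> V -> R) (I J K : V -> V) : Prop := HyperHermitian {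
  hh_linl : forall v, scalar (g ^~ v);
  hh_linr : forall u, scalar (g u);
  hh_sym : forall u v, g u v = g v u;
  hh_nondeg : forall u, (forall v, g u v = 0) -> u = 0;
  hh_linI : linear I; hh_linJ : linear J; hh_linK : linear K;
  hh_skewI : forall u v, g (I u) v = - g u (I v);
  hh_skewJ : forall u v, g (J u) v = - g u (J v);
  hh_skewK : forall u v, g (K u) v = - g u (K v);
  hh_II : forall u, I (I u) = - u;
  hh_JJ : forall u, J (J u) = - u;
  hh_KK : forall u, K (K u) = - u;
  hh_IJ : forall u, I (J u) = K u }.

Definition linear_structure (g : V -> V -> R) (I J K : V -> V) (xi x y : V) : V :=
  g x y *: xi - g y xi *: x
  + ((g (I y) xi *: I x - g x (I y) *: I xi)
     + (g (J y) xi *: J x - g x (J y) *: J xi)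
     + (g (K y) xi *: K x - g x (K y) *: K xi)).

Variables (g : V -> V -> R) (I J K : V -> V).
Hypothesis hh : hyper_hermitian g I J K.

Let gDl a b c : g (a + b) c = g a c + g b c.
Proof. exact: (linear_mapD (W := R^o) (hh_linl hh c)). Qed.
Let gZl k a c : g (k *: a) c = k * g a c.
Proof. exact: (linear_mapZ (W := R^o) (hh_linl hh c)). Qed.
Let gNl a c : g (- a) c = - g a c.
Proof. exact: (linear_mapN (W := R^o) (hh_linl hh c)). Qed.
Let gDr a b c : g c (a + b) = g c a + g c b.
Proof. exact: (linear_mapD (W := R^o) (hh_linr hh c)). Qed.
Let gZr k a c : g c (k *: a) = k * g c a.
Proof. exact: (linear_mapZ (W := R^o) (hh_linr hh c)). Qed.
Let gNr a c : g c (- a) = - g c a.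
Proof. exact: (linear_mapN (W := R^o) (hh_linr hh c)). Qed.
Let g0l v : g 0 v = 0. Proof. by rewrite -(scale0r (0 : V)) gZl mul0r. Qed.
Let gE := (gDl, gDr, gZl, gZr, gNl, gNr).

Let ID := linear_mapD (hh_linI hh). Let IZ := linear_mapZ (hh_linI hh).
Let IN := linear_mapN (hh_linI hh).
Let JD := linear_mapD (hh_linJ hh). Let JZ := linear_mapZ (hh_linJ hh).
Let JN := linear_mapN (hh_linJ hh).
Let KD := linear_mapD (hh_linK hh). Let KZ := linear_mapZ (hh_linK hh).
Let KN := linear_mapN (hh_linK hh).
Let JE := (ID, IZ, IN, JD, JZ, JN, KD, KZ, KN).

Let II := hh_II hh. Let JJ := hh_JJ hh. Let KK := hh_KK hh. Let IJ := hh_IJ hh.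
Let JK u : J (K u) = I u.
Proof. by rewrite -[LHS]opprK -(II (J (K u))) IJ KK IN opprK. Qed.
Let JI u : J (I u) = - K u.
Proof. by rewrite -{1}[u]opprK -(JJ u) IN JN IJ JK IJ. Qed.
Let IK u : I (K u) = - J u. Proof. by rewrite -IJ II. Qed.
Let KJ u : K (J u) = - I u. Proof. by rewrite -IJ JJ IN. Qed.
Let KI u : K (I u) = J u. Proof. by rewrite -IJ JI IN IK opprK. Qed.
Let quat := (II, JJ, KK, IJ, JI, IK, KI, JK, KJ).

Let skewI := hh_skewI hh. Let skewJ := hh_skewJ hh. Let skewK := hh_skewK hh.
Let gC := hh_sym hh.
Let gI0 u : g u (I u) = 0. Proof. have := skewI u u; rewrite gC; lra. Qed.
Let gJ0 u : g u (J u) = 0. Proof. have := skewJ u u; rewrite gC; lra. Qed.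
Let gK0 u : g u (K u) = 0. Proof. have := skewK u u; rewrite gC; lra. Qed.

(** Multiply by the conjugate quaternion a - b I - c J - d K: the product is
    a^2 + b^2 + c^2 + d^2. *)
Lemma quaternion_free xi a b c d : xi <> 0 ->
  a *: xi + b *: I xi + c *: J xi + d *: K xi = 0 ->
  [/\ a = 0, b = 0, c = 0 & d = 0].
Proof.
move=> xi0 q0.
have := congr1 (fun q => a *: q - b *: I q - c *: J q - d *: K q) q0.
rewrite (linear_map0 (hh_linI hh)) (linear_map0 (hh_linJ hh)) (linear_map0 (hh_linK hh)).
rewrite !scaler0 !subr0 !JE !quat.
have -> : forall p q r s : V,
  a *: (a *: p + b *: q + c *: r + d *: s)
  - b *: (a *: q + b *: - p + c *: s + d *: - r)
  - c *: (a *: r + b *: - s + c *: - p + d *: q)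
  - d *: (a *: s + b *: r + c *: - q + d *: - p) =
  (a ^+ 2 + b ^+ 2 + c ^+ 2 + d ^+ 2) *: p.
  by move=> p q r s; apply/rowP => i; rewrite !mxE; ring.
move/eqP; rewrite scaler_eq0 => /orP[/eqP N|/eqP //].
by split; nra.
Qed.

Lemma common_kernel k (f : 'I_k -> V -> R) : (k < m)%N ->
  (forall i, scalar (f i)) -> exists2 y : V, y != 0 & forall i, f i y = 0.
Proof.
move=> km linf; pose A := \matrix_(i < m, j < k) f j (delta_mx 0 i).
have : kermx A != 0.
  by rewrite -mxrank_eq0 mxrank_ker subn_eq0 -ltnNge (leq_ltn_trans (rank_leq_col A)).
case/rowV0Pn => y /sub_kermxP yA y0; exists y => // j.
have := congr1 (fun M : 'rV_k => M 0 j) yA; rewrite !mxE => <-.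
pose l := HB.pack_for {linear V -> R^o} (f j : V -> R^o)
  (GRing.isLinear.Build _ _ _ _ _ (linf j)).
rewrite -[f j y]/(l y) {1}(row_sum_delta y) linear_sum.
by apply: eq_bigr => i _; rewrite linearZ !mxE.
Qed.

(** In dimension > 4 some nonzero y is orthogonal to xi, I xi, J xi and K xi.
    The equation for this y reads
      g(x, y) xi - g(x, I y) I xi - g(x, J y) J xi - g(x, K y) K xi = 0,
    so, if xi is nonzero, g(x, y) = 0 for all x, against nondegeneracy. *)
Lemma linear_structure_eq0 xi : (4 < m)%N ->
  (forall x y, linear_structure g I J K xi x y = 0) -> xi = 0.
Proof.
move=> m4 S0; apply: contrapT => xi0.
have [y y0 gy] := @common_kernel 4
  (fun i => g ^~ (nth 0 [:: xi; I xi; J xi; K xi] i)) m4 (fun i => hh_linl hh _).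
have g0 : g y xi = 0 := gy ord0.
have g1 : g y (I xi) = 0 := gy (lift ord0 ord0).
have g2 : g y (J xi) = 0 := gy (lift ord0 (lift ord0 ord0)).
have g3 : g y (K xi) = 0 := gy (lift ord0 (lift ord0 (lift ord0 ord0))).
move/eqP: y0; apply; apply: (hh_nondeg hh) => x; rewrite gC.
have := S0 x y; rewrite /linear_structure skewI skewJ skewK g0 g1 g2 g3.
rewrite oppr0 !scale0r !sub0r subr0.
rewrite -!scaleNr !addrA => /quaternion_free; case=> //.
Qed.

(** The quaternion-valued 1-form q applied to u and acting on xi; it is the
    covariant derivative of xi along u when xi is isotropic and parallel for
    nabla - S. *)
Definition xi_derivative (xi u : V) : V :=
  g u xi *: xi - (g u (I xi) *: I xi + g u (J xi) *: J xi + g u (K xi) *: K xi).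

Lemma linear_structure_null xi u : g xi xi = 0 ->
  linear_structure g I J K xi u xi = xi_derivative xi u.
Proof.
move=> xi0; rewrite /linear_structure /xi_derivative xi0 !skewI !skewJ !skewK.
by rewrite gI0 gJ0 gK0 !oppr0 !scale0r subr0 !sub0r -!opprD.
Qed.

(** E z u is the covariant derivative along z of [xi_derivative xi u] when
    nabla_z xi = [xi_derivative xi z], up to the term in nabla_z u.  Its symmetry
    is the flatness of q: the exterior derivative of q cancels its commutator. *)
Lemma xi_derivative_sym xi z u :
  let D := xi_derivative xi in
  let E z u := g u (D z) *: xi + g u xi *: D z
    - (g u (I (D z)) *: I xi + g u (I xi) *: I (D z)
       + (g u (J (D z)) *: J xi + g u (J xi) *: J (D z))
       + (g u (K (D z)) *: K xi + g u (K xi) *: K (D z))) in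
  E z u = E u z.
Proof.
rewrite /= /xi_derivative !(gE, JE) !quat !gE.
apply/rowP => i; rewrite !mxE; ring.
Qed.

(** C is an algebraic curvature tensor; [bianchiS] is what the second Bianchi
    identity says when the covariant derivative of C is the action of S on C. *)
Section Curvature.
Variables (xi : V) (C : V -> V -> V -> V).
Hypothesis xi_neq0 : xi <> 0.
Hypothesis linC1 : forall v w, linear (fun u => C u v w).
Hypothesis linC3 : forall u v, linear (fun w => C u v w).
Hypothesis antiC : forall u v w, C u v w = - C v u w.
Hypothesis bianchiC : forall u v w, C u v w + C v w u + C w u v = 0.
Hypothesis skewC : forall u v w z, g (C u v w) z = - g w (C u v z).
Hypothesis CI : forall u v w, C u v (I w) = I (C u v w).
Hypothesis CJ : forall u v w, C u v (J w) = J (C u v w).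
Hypothesis CK : forall u v w, C u v (K w) = K (C u v w).
Hypothesis Cxi : forall u v, C u v xi = 0.
Local Notation S := (linear_structure g I J K xi).
Hypothesis bianchiS : forall u v w z,
  let B z u v := S z (C u v w) - C (S z u) v w - C u (S z v) w - C u v (S z w) in
  B z u v + B u v z + B v z u = 0.

Lemma curvature_pair u v w z : g (C u v w) z = g (C w z u) v.
Proof.
have cyc a b c d : g (C a b c) d + g (C b c a) d + g (C c a b) d = 0.
  by rewrite -!gDl bianchiC g0l.
have sk a b c d : g (C a b c) d = - g (C a b d) c by rewrite skewC gC.
have an a b c d : g (C a b c) d = - g (C b a c) d by rewrite antiC gNl.
have := cyc u v w z; have := cyc v w z u; have := cyc w z u v; have := cyc z u v w.
have := sk u v w z; have := sk v w z u; have := sk w z u v; have := sk z u v w.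
have := sk u w v z; have := sk v z w u.
have := an u v z w; have := an v w u z; have := an w z v u; have := an z u w v.
have := an w u v z; have := an z v w u; have := an w u z v; have := an z v u w.
lra.
Qed.

Let C1D u u' v w : C (u + u') v w = C u v w + C u' v w := linear_mapD (linC1 v w) u u'.
Let C1Z k u v w : C (k *: u) v w = k *: C u v w := linear_mapZ (linC1 v w) k u.
Let C1N u v w : C (- u) v w = - C u v w := linear_mapN (linC1 v w) u.
Let C3D u v w w' : C u v (w + w') = C u v w + C u v w' := linear_mapD (linC3 u v) w w'.
Let C3Z k u v w : C u v (k *: w) = k *: C u v w := linear_mapZ (linC3 u v) k w.
Let C3N u v w : C u v (- w) = - C u v w := linear_mapN (linC3 u v) w.
Let CE := (C1D, C1Z, C1N, C3D, C3Z, C3N).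

Lemma curvature_xi1 v w : C xi v w = 0.
Proof. by apply: (hh_nondeg hh) => z; rewrite curvature_pair Cxi g0l. Qed.

(** By the pair symmetry, the skewness of C u v and its commutation with I are
    properties of C in its first two slots too. *)
Lemma curvature_shiftI u v w : C u (I v) w = - C (I u) v w.
Proof.
apply/eqP; rewrite -subr_eq0 opprK; apply/eqP/(hh_nondeg hh) => z.
by rewrite gDl (curvature_pair u) (curvature_pair (I u)) CI skewI subrr.
Qed.

Lemma curvature_shiftJ u v w : C u (J v) w = - C (J u) v w.
Proof.
apply/eqP; rewrite -subr_eq0 opprK; apply/eqP/(hh_nondeg hh) => z.
by rewrite gDl (curvature_pair u) (curvature_pair (J u)) CJ skewJ subrr.
Qed.

Lemma curvature_shiftK u v w : C u (K v) w = - C (K u) v w.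
Proof.
apply/eqP; rewrite -subr_eq0 opprK; apply/eqP/(hh_nondeg hh) => z.
by rewrite gDl (curvature_pair u) (curvature_pair (K u)) CK skewK subrr.
Qed.

Let CxiI v w : C (I xi) v w = 0.
Proof. by rewrite -[LHS]opprK -curvature_shiftI curvature_xi1 oppr0. Qed.
Let CxiJ v w : C (J xi) v w = 0.
Proof. by rewrite -[LHS]opprK -curvature_shiftJ curvature_xi1 oppr0. Qed.
Let CxiK v w : C (K xi) v w = 0.
Proof. by rewrite -[LHS]opprK -curvature_shiftK curvature_xi1 oppr0. Qed.

Let linear_structure_curvature z u v w : S z (C u v w) = g z (C u v w) *: xi
  - (g z (C u v (I w)) *: I xi + g z (C u v (J w)) *: J xi + g z (C u v (K w)) *: K xi).
Proof.
have perp a : g (C u v a) xi = 0 by rewrite skewC Cxi gC g0l oppr0.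
rewrite /linear_structure -!(CI, CJ, CK) !perp !scale0r.
by apply/rowP => i; rewrite !mxE; ring.
Qed.

Let curvature_linear_structure1 z u v w : C (S z u) v w = - (g u xi *: C z v w
  + (g u (I xi) *: C (I z) v w + g u (J xi) *: C (J z) v w
     + g u (K xi) *: C (K z) v w)).
Proof.
rewrite /linear_structure !CE curvature_xi1 CxiI CxiJ CxiK skewI skewJ skewK.
by apply/rowP => i; rewrite !mxE; ring.
Qed.

Let curvature_linear_structure3 z u v w : C u v (S z w) = - (g w xi *: C u v z
  + (g w (I xi) *: I (C u v z) + g w (J xi) *: J (C u v z)
     + g w (K xi) *: K (C u v z))).
Proof.
rewrite /linear_structure !CE !(CI, CJ, CK) Cxi (linear_map0 (hh_linI hh)).
rewrite (linear_map0 (hh_linJ hh)) (linear_map0 (hh_linK hh)) skewI skewJ skewK.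
by apply/rowP => i; rewrite !mxE; ring.
Qed.

Lemma cyclic_metric u v w z :
  g z (C u v w) = - g u (C v z w) - g v (C z u w).
Proof.
have := congr1 (g w) (bianchiC u v z).
rewrite !gDr (gC w 0) g0l !(gC w) !(skewC _ _ _ w).
rewrite (gC z) (gC u) (gC v) (skewC v z w u) (skewC z u w v) (skewC u v w z); lra.
Qed.

(** After insertion of S, the terms with a vector among xi, I xi, J xi, K xi in
    a slot of C vanish.  The coefficients of these vectors cancel cyclically by
    the first Bianchi identity ([cyclic_metric]), the terms in g(., I xi),
    g(., J xi), g(., K xi) by [curvature_shiftI] and its analogues, and the
    remaining terms occur twice. *)
Lemma cyclic_theta u v z w :
  g u xi *: C v z w + g v xi *: C z u w + g z xi *: C u v w = 0.
Proof.
have := bianchiS u v w z.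
rewrite /= !linear_structure_curvature !curvature_linear_structure3.
rewrite (antiC u (S z v)) (antiC v (S u z)) (antiC z (S v u)).
rewrite !curvature_linear_structure1.
have symI a b : C (I a) b w = C (I b) a w.
  by rewrite (antiC (I b)) curvature_shiftI opprK.
have symJ a b : C (J a) b w = C (J b) a w.
  by rewrite (antiC (J b)) curvature_shiftJ opprK.
have symK a b : C (K a) b w = C (K b) a w.
  by rewrite (antiC (K b)) curvature_shiftK opprK.
(* Bring every term to the cyclically ordered slots (u, v), (v, z), (z, u). *)
rewrite (symI v u) (symI z v) (symI u z) (symJ v u) (symJ z v) (symJ u z).
rewrite (symK v u) (symK z v) (symK u z) (antiC v u w) (antiC z v w) (antiC u z w).
have -> : C z u v = - C u v z - C v z u.
  by apply/eqP; rewrite -subr_eq0 -opprD opprK addrC bianchiC.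
rewrite !JE !(cyclic_metric u v _ z) => H.
apply/rowP => i; move/rowP/(_ i): H; rewrite !mxE.
lra.
Qed.

Lemma cyclic_thetaI u v z w :
  g u (I xi) *: C v z w + g v (I xi) *: C z u w + g z (I xi) *: C u v w = 0.
Proof.
have := cyclic_theta (I u) (I v) (I z) w.
rewrite !curvature_shiftI !II !C1N !opprK !skewI !scaleNr -!opprD.
by move/eqP; rewrite oppr_eq0 => /eqP.
Qed.

Lemma cyclic_thetaJ u v z w :
  g u (J xi) *: C v z w + g v (J xi) *: C z u w + g z (J xi) *: C u v w = 0.
Proof.
have := cyclic_theta (J u) (J v) (J z) w.
rewrite !curvature_shiftJ !JJ !C1N !opprK !skewJ !scaleNr -!opprD.
by move/eqP; rewrite oppr_eq0 => /eqP.
Qed.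

(** If g(u, xi) is nonzero, the quaternion q(u) is invertible, and acting on u
    by its conjugate makes q real. *)
Lemma dual_vector : exists x,
  [/\ g x xi != 0, g x (I xi) = 0, g x (J xi) = 0 & g x (K xi) = 0].
Proof.
have [u gu] : exists u, g u xi <> 0.
  apply: contrapT => /forallNP gn; apply: xi_neq0; apply: (hh_nondeg hh) => v.
  by rewrite gC; apply: contrapT; exact: gn.
exists (g u xi *: u - g u (I xi) *: I u - g u (J xi) *: J u - g u (K xi) *: K u).
rewrite !gE !skewI !skewJ !skewK !quat !gE.
split; last 3 first; try ring.
apply/eqP => N0; have : 0 < g u xi ^+ 2 by rewrite exprn_even_gt0//=; exact/eqP.
have := sqr_ge0 (g u (I xi)); have := sqr_ge0 (g u (J xi)).
by have := sqr_ge0 (g u (K xi)); rewrite !expr2; lra.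
Qed.

(** With x dual to xi, [cyclic_thetaI] expresses C z x by g(z, I xi) and
    [cyclic_thetaJ] expresses it by g(z, J xi); these forms are independent, so
    C z x = 0, and [cyclic_theta] expresses C by such terms. *)
Lemma curvature_eq0 u v w : C u v w = 0.
Proof.
have [x [x0 xI xJ xK]] := dual_vector.
have yI : g (I x) (I xi) = g x xi by rewrite skewI II gNr opprK.
have yJ : g (J x) (J xi) = g x xi by rewrite skewJ JJ gNr opprK.
have yJI : g (J x) (I xi) = 0 by rewrite skewJ JI gNr opprK.
have hI z : g x xi *: C z x w + g z (I xi) *: C x (I x) w = 0.
  by have := cyclic_thetaI x (I x) z w; rewrite xI yI scale0r add0r.
have CJx : C (J x) x w = 0.
  have := hI (J x); rewrite yJI scale0r addr0 => /eqP.
  by rewrite scaler_eq0 (negPf x0) => /eqP.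
have Cx z : C z x w = 0.
  have := cyclic_thetaJ x (J x) z w.
  rewrite xJ yJ scale0r add0r (antiC x) CJx oppr0 scaler0 addr0 => /eqP.
  by rewrite scaler_eq0 (negPf x0) => /eqP.
have := cyclic_theta x u v w.
rewrite (antiC x) !Cx oppr0 !scaler0 !addr0 => /eqP.
by rewrite scaler_eq0 (negPf x0) => /eqP.
Qed.

End Curvature.
End HyperHermitian.

(** * Covariant derivatives and the Ricci identity *)

Section Connection.
Variables (R : realType) (m : nat).
Local Notation V := 'rV[R]_m.
Variables (U : set V) (G : V -> V -> V -> V).
Hypothesis openU : open U.
Hypothesis linG : forall x u, U x -> linear (G x u).

Local Notation nab u := (nabla G (cst u)).

Lemma nabla_cst u v x : nab u (cst v) x = G x u v.
Proof. by rewrite /nabla derive_cst add0r. Qed.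

Lemma nabla_near u Y Z x : (\forall y \near x, Y y = Z y) ->
  nab u Y x = nab u Z x.
Proof. by move=> YZ; rewrite /nabla (near_eq_derive _ YZ) (nbhs_singleton YZ). Qed.

Lemma nabla_eq u Y Z x : U x -> (forall y, U y -> Y y = Z y) ->
  nab u Y x = nab u Z x.
Proof.
move=> Ux YZ; apply: nabla_near; near=> y; apply: YZ; near: y.
exact: open_nbhs_nbhs.
Unshelve. all: by end_near. Qed.

Lemma nablaD u Y Z x : U x -> differentiable Y x -> differentiable Z x ->
  nab u (fun y => Y y + Z y) x = nab u Y x + nab u Z x.
Proof.
move=> Ux dY dZ; rewrite /nabla deriveD; try exact/diff_derivable.
by rewrite /cst (linear_mapD (linG _ Ux)) addrACA.
Qed.

Lemma nablaN u Y x : U x -> differentiable Y x ->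
  nab u (fun y => - Y y) x = - nab u Y x.
Proof.
move=> Ux dY; rewrite /nabla deriveN; last exact/diff_derivable.
by rewrite /cst (linear_mapN (linG _ Ux)) opprD.
Qed.

Lemma nablaB u Y Z x : U x -> differentiable Y x -> differentiable Z x ->
  nab u (fun y => Y y - Z y) x = nab u Y x - nab u Z x.
Proof.
by move=> Ux dY dZ; rewrite nablaD ?nablaN//; exact: differentiableN.
Qed.

Lemma nablaZ u (k : V -> R^o) Y x : U x -> differentiable k x -> differentiable Y x ->
  nab u (fun y => k y *: Y y) x = 'D_u k x *: Y x + k x *: nab u Y x.
Proof.
move=> Ux dk dY; rewrite /nabla (differentiable_scale dk dY).2.
by rewrite /cst (linear_mapZ (linG _ Ux)) scalerDr addrA.
Qed.

End Connection.

Section LeviCivita.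
Variables (R : realType) (m : nat).
Local Notation V := 'rV[R]_m.
Variables (U : set V) (G : V -> V -> V -> V).
Hypothesis openU : open U.
Hypothesis linG : forall x, U x ->
  (forall u, linear (G x u)) /\ (forall v, linear (G x ^~ v)).
Hypothesis smoothG : forall u v, smooth U (fun x => G x u v).
Hypothesis symG : forall x u v, U x -> G x u v = G x v u.

Local Notation nab u := (nabla G (cst u)).
Local Notation C x u v w := (curvature G (cst u) (cst v) (cst w) x).

Let linG1 x u : U x -> linear (G x u). Proof. by case/linG. Qed.
Let dG x u v : U x -> differentiable (fun y => G y u v) x.
Proof. exact: smooth_differentiable. Qed.

Lemma nabla_differentiable u Y x : smooth U Y -> U x -> differentiable (nab u Y) x.
Proof.
move=> sY Ux; apply: differentiableD.
  by have := smooth_differentiable (smooth_derive sY u) Ux.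
have dY := smooth_differentiable sY Ux.
by have [] := @leibniz2 R m _ U G (cst u) Y x openU Ux linG (fun u v => dG u v Ux)
  (differentiable_cst u x) dY.
Qed.

Lemma smooth_nabla_cst u v : smooth U (nab u (cst v)).
Proof.
by rewrite (_ : nab u (cst v) = fun x => G x u v)//; apply/funext => x;
  rewrite nabla_cst.
Qed.

Lemma curvature_nabla x u v w : U x ->
  C x u v w = nab u (nab v (cst w)) x - nab v (nab u (cst w)) x.
Proof.
move=> Ux; rewrite /curvature (_ : bracket _ _ = cst 0); last first.
  by apply/funext => y; rewrite /bracket !derive_cst subrr.
by rewrite nabla_cst (linear_map0 ((linG Ux).2 _)) subr0.
Qed.

(** The terms of first and second order in Y are symmetric in u and v, so only
    the curvature survives the antisymmetrization. *)
Lemma nabla2E u v Y x : smooth U Y -> U x -> nab u (nab v Y) x =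
  'D_u ('D_v Y) x + 'D_u (fun y => G y v (Y x)) x + G x v ('D_u Y x)
  + G x u ('D_v Y x) + G x u (G x v (Y x)).
Proof.
move=> sY Ux; have dY := smooth_differentiable sY Ux.
have [d D] := @leibniz2 R m _ U G (cst v) Y x openU Ux linG (fun u v => dG u v Ux)
  (differentiable_cst v x) dY.
rewrite {1}/nabla deriveD; last 2 first.
- exact/diff_derivable/(smooth_differentiable (smooth_derive sY v)).
- exact/diff_derivable.
rewrite D derive_cst (linear_map0 ((linG Ux).2 _)) addr0 /nabla/=.
by rewrite (linear_mapD (linG1 _ Ux)) !addrA.
Qed.

Lemma nabla2_cst u v w x : nab u (nab v (cst w)) x =
  'D_u (fun y => G y v w) x + G x u (G x v w).
Proof.
rewrite (_ : nab v (cst w) = fun y => G y v w)//.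
by apply/funext => y; rewrite nabla_cst.
Qed.

Lemma curvatureE x u v w : U x ->
  C x u v w = 'D_u (fun y => G y v w) x + G x u (G x v w)
              - ('D_v (fun y => G y u w) x + G x v (G x u w)).
Proof. by move=> Ux; rewrite curvature_nabla// !nabla2_cst. Qed.

Lemma ricci u v Y x : smooth U Y -> U x ->
  nab u (nab v Y) x - nab v (nab u Y) x = C x u v (Y x).
Proof.
move=> sY Ux; rewrite (curvatureE _ _ _ Ux).
rewrite (nabla2E u v sY Ux) (nabla2E v u sY Ux).
move: (schwarz_row v u openU sY Ux).
generalize ('D_u ('D_v Y) x) ('D_v ('D_u Y) x) => a b ->.
have rearr (p q r s t q' t' : V) :
    p + q + r + s + t - (p + q' + s + r + t') = q + t - (q' + t').
  by apply/rowP => i; rewrite !mxE; ring.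
exact: rearr.
Qed.

(** By the Ricci identity B z u v is the double commutator
    [nabla_z, [nabla_u, nabla_v]] applied to w, so this is the Jacobi identity. *)
Lemma bianchi2 x z u v w : U x ->
  let B z u v := nab z (fun y => C y u v w) x - C x u v (nab z (cst w) x) in
  B z u v + B u v z + B v z u = 0.
Proof.
move=> Ux B.
have E z' u' v' : B z' u' v' =
    nab z' (nab u' (nab v' (cst w))) x - nab z' (nab v' (nab u' (cst w))) x
    - (nab u' (nab v' (nab z' (cst w))) x - nab v' (nab u' (nab z' (cst w))) x).
  rewrite /B -ricci//; last exact: smooth_nabla_cst.
  rewrite (nabla_eq G openU z' Ux (fun y => @curvature_nabla y u' v' w)).
  have d a b : differentiable (nab a (nab b (cst w))) x.
    exact: nabla_differentiable (smooth_nabla_cst b w) Ux.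
  by rewrite (nablaB linG1 z' Ux (d u' v') (d v' u')).
have jacobi (a b c a' b' c' : V) :
    a - b - (c - c') + (c - a' - (b' - b)) + (b' - c' - (a - a')) = 0.
  by apply/rowP => i; rewrite !mxE; ring.
rewrite !E; exact: jacobi.
Qed.

Lemma curvature_anti x u v w : U x -> C x u v w = - C x v u w.
Proof. by move=> Ux; rewrite !curvature_nabla// opprB. Qed.

Lemma bianchi1 x u v w : U x -> C x u v w + C x v w u + C x w u v = 0.
Proof.
move=> Ux; have nabC a b c : nab a (nab b (cst c)) x = nab a (nab c (cst b)) x.
  by apply: (nabla_eq G openU a Ux) => y Uy; rewrite !nabla_cst symG.
rewrite !curvature_nabla// (nabC u v w) (nabC v w u) (nabC w u v).
have cyclic (a b c : V) : a - b + (b - c) + (c - a) = 0.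
  by apply/rowP => i; rewrite !mxE; ring.
exact: cyclic.
Qed.

Lemma derive_comb (f g h : V -> V) (k : R) z x : U x ->
  (forall y, U y -> f y = k *: g y + h y) ->
  differentiable g x -> differentiable h x ->
  'D_z f x = k *: 'D_z g x + 'D_z h x.
Proof.
move=> Ux E dg dh; rewrite (near_eq_derive (g := (k *: g) + h)).
  rewrite deriveD; last exact/diff_derivable.
    by rewrite deriveZ//; exact/diff_derivable.
  exact/derivableZ/diff_derivable.
near=> y; apply: E; near: y; exact: open_nbhs_nbhs.
Unshelve. all: by end_near. Qed.

Let rearrange (k : R) (p q r s p' q' r' s' : V) :
  k *: p + p' + (k *: q + q') - (k *: r + r' + (k *: s + s')) =
  k *: (p + q - (r + s)) + (p' + q' - (r' + s')).
Proof. by apply/rowP => i; rewrite !mxE; ring. Qed.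

Lemma curvature_linear3 x u v : U x -> linear (fun w => C x u v w).
Proof.
move=> Ux k a b; rewrite !(curvatureE _ _ _ Ux).
have E c d : 'D_c (fun y => G y d (k *: a + b)) x =
    k *: 'D_c (fun y => G y d a) x + 'D_c (fun y => G y d b) x.
  by apply: derive_comb => // [y Uy||]; [exact: linG1|exact: dG..].
by rewrite !E !(linG1 _ Ux) rearrange.
Qed.

Lemma curvature_linear1 x v w : U x -> linear (fun u => C x u v w).
Proof.
move=> Ux k a b; rewrite !(curvatureE _ _ _ Ux).
have -> : 'D_v (fun y => G y (k *: a + b) w) x =
    k *: 'D_v (fun y => G y a w) x + 'D_v (fun y => G y b w) x.
  by apply: derive_comb => // [y Uy||]; [exact: (linG Uy).2|exact: dG..].
have -> : 'D_(k *: a + b) (fun y => G y v w) x =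
    k *: 'D_a (fun y => G y v w) x + 'D_b (fun y => G y v w) x.
  by rewrite !(deriveE _ (dG v w Ux)); exact: linearP.
have l c : G x (k *: a + b) c = k *: G x a c + G x b c := (linG Ux).2 c k a b.
have lv c d : G x v (k *: c + d) = k *: G x v c + G x v d := linG1 v Ux k c d.
rewrite (l (G x v w)) (l w) lv.
exact: rearrange.
Qed.

End LeviCivita.

(** * Parallel tensors and the symmetries of the curvature *)

Section ParallelTensors.
Variables (R : realType) (m : nat).
Local Notation V := 'rV[R]_m.
Variables (U : set V) (G : V -> V -> V -> V).
Hypothesis openU : open U.
Local Notation nab u := (nabla G (cst u)).

Section Endomorphism.
Variable J : V -> V -> V.
Hypothesis linJ : forall x, U x -> linear (J x).
Hypothesis smoothJ : forall u, smooth U (fun x => J x u).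

Lemma differentiable_app Y x : U x -> differentiable Y x ->
  differentiable (fun y => J y (Y y)) x.
Proof.
move=> Ux dY; have dJ e : differentiable (J^~ e) x by exact: smooth_differentiable Ux.
by have [] := leibniz1 openU Ux linJ dJ dY.
Qed.

Hypothesis parJ : forall x u v, U x -> cov11 G J (cst u) (cst v) x = 0.

Lemma nabla_app u Y x : U x -> differentiable Y x ->
  nab u (fun y => J y (Y y)) x = J x (nab u Y x).
Proof.
move=> Ux dY; have dJ e : differentiable (J^~ e) x by exact: smooth_differentiable Ux.
have [_ D] := leibniz1 openU Ux linJ dJ dY.
have /eqP := parJ u (Y x) Ux; rewrite /cov11 subr_eq0 nabla_cst => /eqP P.
by rewrite /nabla D addrAC [X in X + _]P -(linear_mapD (linJ Ux)) addrC.
Qed.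

End Endomorphism.

Section Metric.
Variable g : V -> V -> V -> R.
Hypothesis ling : forall x, U x ->
  (forall u, scalar (g x u)) /\ (forall v, scalar (g x ^~ v)).
Hypothesis smoothg : forall u v, smooth U (fun x => g x u v : R^o).

Let leibnizg Y Z x : U x -> differentiable Y x -> differentiable Z x ->
  differentiable (fun y => g y (Y y) (Z y) : R^o) x /\
  forall z, 'D_z (fun y => g y (Y y) (Z y) : R^o) x =
    'D_z (fun y => g y (Y x) (Z x) : R^o) x
    + g x ('D_z Y x) (Z x) + g x (Y x) ('D_z Z x).
Proof.
move=> Ux dY dZ; apply: (@leibniz2 R m R^o U g Y Z x openU Ux ling) => // u v.
by have := smooth_differentiable (smoothg u v) Ux.
Qed.

Lemma differentiable_metric Y Z x : U x -> differentiable Y x -> differentiable Z x ->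
  differentiable (fun y => g y (Y y) (Z y) : R^o) x.
Proof. by move=> Ux dY dZ; case: (leibnizg Ux dY dZ). Qed.

Hypothesis parg : forall x u v w, U x -> cov02 G g (cst u) (cst v) (cst w) x = 0.

Lemma derive_metric u Y Z x : U x -> differentiable Y x -> differentiable Z x ->
  'D_u (fun y => g y (Y y) (Z y) : R^o) x = g x (nab u Y x) (Z x) + g x (Y x) (nab u Z x).
Proof.
move=> Ux dY dZ; have [_ ->] := leibnizg Ux dY dZ.
have := parg u (Y x) (Z x) Ux; rewrite /cov02 !nabla_cst /= => /eqP.
rewrite -addrA -opprD subr_eq0 => /eqP ->; have [l1 l2] := ling Ux.
rewrite /nabla (linear_mapD (V := V) (W := R^o) (l1 (Y x))).
rewrite (linear_mapD (V := V) (W := R^o) (l2 (Z x))) /=.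
have rearr (p q r s : R) : p + q + r + s = r + p + (s + q) by ring.
exact: rearr.
Qed.

Hypothesis linG : forall x u, U x -> linear (G x u).

Lemma nabla_metric_scale u X Y Z x : U x -> differentiable X x ->
    differentiable Y x -> differentiable Z x ->
  nab u (fun y => g y (X y) (Y y) *: Z y) x =
    (g x (nab u X x) (Y x) + g x (X x) (nab u Y x)) *: Z x
    + g x (X x) (Y x) *: nab u Z x.
Proof.
move=> Ux dX dY dZ.
rewrite (nablaZ linG u Ux (differentiable_metric Ux dX dY) dZ).
by rewrite derive_metric.
Qed.

End Metric.

End ParallelTensors.

Section CurvatureSymmetries.
Variables (R : realType) (m : nat).
Local Notation V := 'rV[R]_m.
Variables (U : set V) (G : V -> V -> V -> V).
Hypothesis openU : open U.
Hypothesis linG : forall x, U x ->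
  (forall u, linear (G x u)) /\ (forall v, linear (G x ^~ v)).
Hypothesis smoothG : forall u v, smooth U (fun x => G x u v).

Local Notation nab u := (nabla G (cst u)).
Local Notation C x u v w := (curvature G (cst u) (cst v) (cst w) x).

Let smooth_nab u v : smooth U (nab u (cst v)) := smooth_nabla_cst smoothG u v.

(** A parallel J commutes with each nabla_u, hence with their commutator. *)
Lemma curvature_commute (J : V -> V -> V) x u v w :
  (forall x, U x -> linear (J x)) -> (forall u, smooth U (fun x => J x u)) ->
  (forall x u v, U x -> cov11 G J (cst u) (cst v) x = 0) -> U x ->
  C x u v (J x w) = J x (C x u v w).
Proof.
move=> linJ smoothJ parJ Ux.
have nab2 a b : nab a (nab b (fun y => J y w)) x = J x (nab a (nab b (cst w)) x).
  have dn : differentiable (nab b (cst w)) x by exact: smooth_differentiable Ux.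
  rewrite -(nabla_app openU linJ smoothJ parJ a Ux dn).
  apply: (nabla_eq G openU a Ux) => y Uy.
  exact: (nabla_app openU linJ smoothJ parJ b Uy (differentiable_cst w y)).
have JB a b : J x (a - b) = J x a - J x b.
  by rewrite (linear_mapD (linJ x Ux)) (linear_mapN (linJ x Ux)).
rewrite (curvature_nabla linG u v w Ux) JB.
exact: etrans (esym (ricci openU linG smoothG u v (smoothJ w) Ux))
  (congr2 (fun a b => a - b) (nab2 u v) (nab2 v u)).
Qed.

(** Second derivatives of g(w, z) commute; written by means of nabla, which is
    a metric connection, their difference is g(R w, z) + g(w, R z). *)
Lemma curvature_skew (g : V -> V -> V -> R) x u v w z :
  (forall x, U x -> (forall u, scalar (g x u)) /\ (forall v, scalar (g x ^~ v))) ->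
  (forall u v, smooth U (fun x => g x u v : R^o)) ->
  (forall x u v w, U x -> cov02 G g (cst u) (cst v) (cst w) x = 0) -> U x ->
  g x (C x u v w) z = - g x w (C x u v z).
Proof.
move=> ling smoothg parg Ux.
have dc (a : V) y : differentiable (cst a : V -> V) y := differentiable_cst a y.
have dn a b y : U y -> differentiable (nab a (cst b)) y.
  by move=> Uy; exact: smooth_differentiable Uy.
have D2 a b : 'D_a ('D_b (fun y => g y w z : R^o)) x =
    g x (nab a (nab b (cst w)) x) z + g x (nab b (cst w) x) (nab a (cst z) x)
    + (g x (nab a (cst w) x) (nab b (cst z) x) + g x w (nab a (nab b (cst z)) x)).
  have dg := differentiable_metric openU ling smoothg Ux.
  have Dg := derive_metric openU ling smoothg parg.
  rewrite -(Dg a _ _ x Ux (dn b w x Ux) (dc z x)).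
  rewrite -(Dg a _ _ x Ux (dc w x) (dn b z x Ux)).
  rewrite -deriveD; last 2 first.
  - exact/diff_derivable/(dg _ _ (dn b w x Ux) (dc z x)).
  - exact/diff_derivable/(dg _ _ (dc w x) (dn b z x Ux)).
  apply: near_eq_derive; near=> y.
  have Uy : U y by near: y; exact: open_nbhs_nbhs.
  exact: (Dg b _ _ y Uy (dc w y) (dc z y)).
have [l1 l2] := ling x Ux.
have l1B a b : g x w (a - b) = g x w a - g x w b.
  by rewrite (linear_mapD (W := R^o) (l1 w)) (linear_mapN (W := R^o) (l1 w)).
have l2B a b : g x (a - b) z = g x a z - g x b z.
  by rewrite (linear_mapD (W := R^o) (l2 z)) (linear_mapN (W := R^o) (l2 z)).
rewrite (curvature_nabla linG u v w Ux) (curvature_nabla linG u v z Ux) l1B l2B.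
have := schwarz u v openU (smoothg w z) Ux; rewrite !D2.
have rearr (p q r s p' s' : R) :
    p + q + (r + s) = p' + r + (q + s') -> p - p' = - (s - s') by lra.
exact: rearr.
Unshelve. all: by end_near. Qed.

End CurvatureSymmetries.

(** * Covariant derivatives of the tensors of linear type *)

Section CovariantLeibniz.
Variables (R : realType) (m : nat).
Local Notation V := 'rV[R]_m.
Variables (U : set V) (G : V -> V -> V -> V) (g : V -> V -> V -> R).
Hypothesis openU : open U.
Hypothesis linG : forall x u, U x -> linear (G x u).
Hypothesis ling : forall x, U x ->
  (forall u, scalar (g x u)) /\ (forall v, scalar (g x ^~ v)).
Hypothesis smoothg : forall u v, smooth U (fun x => g x u v : R^o).
Hypothesis parg : forall x u v w, U x -> cov02 G g (cst u) (cst v) (cst w) x = 0.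

Variables (z x : V).
Hypothesis Ux : U x.

(** Differentiability is carried along with the value, so that the derivative
    of a compound expression is assembled from those of its parts. *)
Definition is_nabla (Y : V -> V) (Y' : V) :=
  differentiable Y x /\ nabla G (cst z) Y x = Y'.

Lemma is_nabla_cst u : is_nabla (cst u) (G x z u).
Proof. by split; [exact: differentiable_cst|rewrite nabla_cst]. Qed.

Lemma is_nablaD Y Z Y' Z' : is_nabla Y Y' -> is_nabla Z Z' ->
  is_nabla (fun y => Y y + Z y) (Y' + Z').
Proof.
move=> [dY <-] [dZ <-]; split; first exact: differentiableD.
exact: (nablaD linG z Ux dY dZ).
Qed.

Lemma is_nablaB Y Z Y' Z' : is_nabla Y Y' -> is_nabla Z Z' ->
  is_nabla (fun y => Y y - Z y) (Y' - Z').
Proof.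
move=> [dY <-] [dZ <-]; split; first exact: differentiableB.
exact: (nablaB linG z Ux dY dZ).
Qed.

Lemma is_nabla_metric X Y Z X' Y' Z' :
  is_nabla X X' -> is_nabla Y Y' -> is_nabla Z Z' ->
  is_nabla (fun y => g y (X y) (Y y) *: Z y)
    ((g x X' (Y x) + g x (X x) Y') *: Z x + g x (X x) (Y x) *: Z').
Proof.
move=> [dX <-] [dY <-] [dZ <-]; split.
  have dg := differentiable_metric openU ling smoothg Ux dX dY.
  exact: (differentiable_scale dg dZ).1.
exact: (nabla_metric_scale openU ling smoothg parg linG z Ux dX dY dZ).
Qed.

Definition parallel_field (J : V -> V -> V) :=
  [/\ forall x, U x -> linear (J x), forall u, smooth U (fun x => J x u)
    & forall x u v, U x -> cov11 G J (cst u) (cst v) x = 0].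

Lemma is_nabla_app J Y Y' : parallel_field J -> is_nabla Y Y' ->
  is_nabla (fun y => J y (Y y)) (J x Y').
Proof.
move=> [linJ smoothJ parJ] [dY <-]; split.
  exact: (differentiable_app openU linJ smoothJ Ux dY).
exact: (nabla_app openU linJ smoothJ parJ z Ux dY).
Qed.

Variables I J K : V -> V -> V.
Hypotheses (pI : parallel_field I) (pJ : parallel_field J) (pK : parallel_field K).

(** The metric and the complex structures being parallel, only the arguments
    and xi are differentiated. *)
Lemma is_nabla_linear_structure X Y xi X' Y' xi' :
  is_nabla X X' -> is_nabla Y Y' -> is_nabla xi xi' ->
  is_nabla (fun y => linear_structure (g y) (I y) (J y) (K y) (xi y) (X y) (Y y))
    (linear_structure (g x) (I x) (J x) (K x) (xi x) X' (Y x)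
     + linear_structure (g x) (I x) (J x) (K x) (xi x) (X x) Y'
     + linear_structure (g x) (I x) (J x) (K x) xi' (X x) (Y x)).
Proof.
move=> nX nY nxi.
have nT A (pA : parallel_field A) := is_nablaB
  (is_nabla_metric (is_nabla_app pA nY) nxi (is_nabla_app pA nX))
  (is_nabla_metric nX (is_nabla_app pA nY) (is_nabla_app pA nxi)).
have [d N] := is_nablaD
  (is_nablaB (is_nabla_metric nX nY nxi) (is_nabla_metric nY nxi nX))
  (is_nablaD (is_nablaD (nT I pI) (nT J pJ)) (nT K pK)).
split; first exact: d.
rewrite -[LHS]/(nabla G (cst z) _ x) [LHS]N /linear_structure.
apply/rowP => i; rewrite !mxE.
ring.
Qed.

Lemma is_nabla_xi_derivative u xi xi' : is_nabla xi xi' ->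
  is_nabla (fun y => xi_derivative (g y) (I y) (J y) (K y) (xi y) u)
    (xi_derivative (g x) (I x) (J x) (K x) (xi x) (G x z u)
     + (g x u xi' *: xi x + g x u (xi x) *: xi'
    - (g x u (I x xi') *: I x (xi x) + g x u (I x (xi x)) *: I x xi'
       + (g x u (J x xi') *: J x (xi x) + g x u (J x (xi x)) *: J x xi')
       + (g x u (K x xi') *: K x (xi x) + g x u (K x (xi x)) *: K x xi')))).
Proof.
move=> nxi; have nu := is_nabla_cst u.
have nT A (pA : parallel_field A) :=
  is_nabla_metric nu (is_nabla_app pA nxi) (is_nabla_app pA nxi).
have [d N] := is_nablaB (is_nabla_metric nu nxi nxi)
  (is_nablaD (is_nablaD (nT I pI) (nT J pJ)) (nT K pK)).
split; first exact: d.
rewrite [LHS]N /xi_derivative /=.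
apply/rowP => i; rewrite !mxE.
ring.
Qed.

End CovariantLeibniz.

(** * Flatness in a chart *)

Section Chart.
Variables (R : realType) (m : nat).
Local Notation V := 'rV[R]_m.
Variables (U : set V) (G : V -> V -> V -> V) (g : V -> V -> V -> R).
Variables (I J K : V -> V -> V) (S : V -> V -> V -> V) (xi : V -> V).
Hypothesis m_gt4 : (4 < m)%N.
Hypothesis openU : open U.
Hypothesis linG : forall x, U x ->
  (forall u, linear (G x u)) /\ (forall v, linear (G x ^~ v)).
Hypothesis smoothG : forall u v, smooth U (fun x => G x u v).
Hypothesis symG : forall x u v, U x -> G x u v = G x v u.
Hypothesis ling : forall x, U x ->
  (forall u, scalar (g x u)) /\ (forall v, scalar (g x ^~ v)).
Hypothesis smoothg : forall u v, smooth U (fun x => g x u v : R^o).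
Hypothesis parg : forall x u v w, U x -> cov02 G g (cst u) (cst v) (cst w) x = 0.
Hypotheses (parI : parallel_field U G I) (parJ : parallel_field U G J)
  (parK : parallel_field U G K).
Hypothesis hh : forall x, U x -> hyper_hermitian (g x) (I x) (J x) (K x).
Hypothesis smoothxi : smooth U xi.
Hypothesis xi_neq0 : forall x, U x -> xi x <> 0.
Hypothesis xi_null : forall x, U x -> g x (xi x) (xi x) = 0.
Hypothesis SE : forall x u v, U x ->
  S x u v = linear_structure (g x) (I x) (J x) (K x) (xi x) u v.
Hypothesis linS : forall x u, U x -> linear (S x u).

Local Notation G' := (fun x u v => G x u v - S x u v).
Local Notation C x u v w := (curvature G (cst u) (cst v) (cst w) x).
Hypothesis parg' : forall x u v w, U x -> cov02 G' g (cst u) (cst v) (cst w) x = 0.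
Hypotheses (parI' : parallel_field U G' I) (parJ' : parallel_field U G' J)
  (parK' : parallel_field U G' K).
Hypothesis parS' : forall x u v w, U x -> cov12 G' S (cst u) (cst v) (cst w) x = 0.
Hypothesis parC' : forall x u v w z, U x ->
  cov13 G' (fun x u v w => C x u v w) (cst u) (cst v) (cst w) (cst z) x = 0.

Let linG1 x u : U x -> linear (G x u). Proof. by case/linG. Qed.
Let linG' x u : U x -> linear (fun v => G x u v - S x u v).
Proof.
move=> Ux k a b; rewrite (linG1 u Ux) (linS u Ux) scalerBr.
by rewrite opprD addrACA.
Qed.

Lemma nablaSE z Y x : nabla G' (cst z) Y x = nabla G (cst z) Y x - S x z (Y x).
Proof. by rewrite /nabla addrA. Qed.

Lemma xi_parallel z x : U x -> nabla G' (cst z) xi x = 0.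
Proof.
move=> Ux; apply: (linear_structure_eq0 (hh Ux) m_gt4) => u v.
have nc a : is_nabla G' z x (cst a) (G x z a - S x z a) := is_nabla_cst G' z x a.
have nxi : is_nabla G' z x xi (nabla G' (cst z) xi x).
  by split=> //; have := smooth_differentiable smoothxi Ux.
have [_ N] := is_nabla_linear_structure openU linG' ling smoothg parg' Ux
  parI' parJ' parK' (nc u) (nc v) nxi.
have := parS' z u v Ux; rewrite /cov12.
rewrite (nabla_eq G' openU z Ux (fun y Uy => SE u v Uy)) [X in X - _ - _]N.
rewrite !(nabla_cst G') !(SE _ _ Ux) /cst.
have cancel (a b c : V) : a + b + c - a - b = c.
  by apply/rowP => i; rewrite !mxE; ring.
by rewrite cancel.
Qed.

Lemma nabla_xi z x : U x ->
  nabla G (cst z) xi x = xi_derivative (g x) (I x) (J x) (K x) (xi x) z.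
Proof.
move=> Ux; have /eqP := xi_parallel z Ux.
rewrite nablaSE subr_eq0 (SE _ _ Ux).
by rewrite (linear_structure_null (hh Ux) _ (xi_null Ux)) => /eqP.
Qed.

Lemma curvature_xi u v x : U x -> C x u v (xi x) = 0.
Proof.
move=> Ux; rewrite -(ricci openU linG smoothG u v smoothxi Ux).
have nxi a : is_nabla G a x xi (xi_derivative (g x) (I x) (J x) (K x) (xi x) a).
  by split; [have := smooth_differentiable smoothxi Ux|exact: nabla_xi].
have N a b : nabla G (cst a) (nabla G (cst b) xi) x = _ := etrans
  (nabla_eq G openU a Ux (fun y Uy => nabla_xi b Uy))
  (is_nabla_xi_derivative openU linG1 ling smoothg parg Ux parI parJ parK
     b (nxi a)).2.
apply/eqP; rewrite subr_eq0; apply/eqP.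
apply: (etrans (N u v)); apply: (etrans _ (esym (N v u))).
exact: (congr2 (fun a b => xi_derivative (g x) (I x) (J x) (K x) (xi x) a + b)
  (symG u v Ux) (xi_derivative_sym (hh Ux) (xi x) u v)).
Qed.

(** nabla' C = 0 gives nabla C = S . C.  The Christoffel terms of nabla C in
    the first two slots cancel in the cyclic sum because G is symmetric, and
    those in the last slot belong to [bianchi2]. *)
Lemma bianchi_linear u v w z x : U x ->
  let B z u v := S x z (C x u v w) - C x (S x z u) v w - C x u (S x z v) w
    - C x u v (S x z w) in
  B z u v + B u v z + B v z u = 0.
Proof.
move=> Ux B; pose c a b d := C x a b d.
pose n a b d := nabla G (cst a) (fun y => C y b d w) x.
have c1B a a' b d : c (a - a') b d = c a b d - c a' b d.
  have l := curvature_linear1 openU linG smoothG b d Ux.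
  by rewrite /c (linear_mapD l) (linear_mapN l).
have cA a b d : c a b d = - c b a d by exact: (curvature_anti linG a b d Ux).
have c2B a b b' d : c a (b - b') d = c a b d - c a b' d.
  by rewrite cA c1B (cA a b) (cA a b') opprB addrC opprK.
have c3B a b d d' : c a b (d - d') = c a b d - c a b d'.
  have l := curvature_linear3 openU linG smoothG a b Ux.
  by rewrite /c (linear_mapD l) (linear_mapN l).
have E a b d : B a b d = n a b d - c (G x a b) d w - c b (G x a d) w - c b d (G x a w).
  have := parC' a b d w Ux; rewrite /cov13 !(nabla_cst G') nablaSE.
  rewrite -[nabla G _ _ x]/(n a b d) /B -/(c b d w).
  rewrite -![curvature _ _ _ _ x]/(c _ _ _) c1B c2B c3B.
  have rearr (p s q q' r r' t t' : V) :
      p - s - (q - q') - (r - r') - (t - t') = 0 ->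
      s - q' - r' - t' = p - q - r - t.
    move/rowP => H; apply/rowP => i; move: (H i); rewrite !mxE; lra.
  exact: rearr.
have := bianchi2 openU linG smoothG z u v w Ux.
rewrite /= !nabla_cst -![nabla G _ _ x]/(n _ _ _) -![curvature _ _ _ _ x]/(c _ _ _).
rewrite !E (symG u z Ux) (symG v u Ux) (symG z v Ux).
rewrite (cA v (G x z u)) (cA z (G x u v)) (cA u (G x v z)).
have rearr (p p' p'' q q' q'' r r' r'' : V) : p - q + (p' - q') + (p'' - q'') = 0 ->
    p - r - - r' - q + (p' - r'' - - r - q') + (p'' - r' - - r'' - q'') = 0.
  by move/rowP => H; apply/rowP => i; move: (H i); rewrite !mxE; lra.
exact: rearr.
Qed.

Lemma chart_flat u v w x : U x -> C x u v w = 0.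
Proof.
move=> Ux.
have cI := curvature_commute openU linG smoothG.
case: parI parJ parK => [lI sI pI] [lJ sJ pJ] [lK sK pK].
apply: (curvature_eq0 (hh Ux) (xi_neq0 Ux) (C := fun u v w => C x u v w)).
- by move=> a b; exact: (curvature_linear1 openU linG smoothG a b Ux).
- by move=> a b; exact: (curvature_linear3 openU linG smoothG a b Ux).
- by move=> a b d; exact: (curvature_anti linG a b d Ux).
- by move=> a b d; exact: (bianchi1 openU linG symG a b d Ux).
- move=> a b d e.
  exact: (curvature_skew openU linG smoothG a b d e ling smoothg parg Ux).
- by move=> a b d; exact: (cI I x a b d lI sI pI Ux).
- by move=> a b d; exact: (cI J x a b d lJ sJ pJ Ux).
- by move=> a b d; exact: (cI K x a b d lK sK pK Ux).
- by move=> a b; exact: (curvature_xi a b Ux).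
- by move=> a b d e; have := bianchi_linear a b d e Ux; rewrite /= !(SE _ _ Ux).
Qed.

End Chart.

Theorem mainTheorem5 (R : realType) (n : nat) (hn : (8 <= 4 * n)%N)
    (M : manifold R (4 * n))
    (g : chart M -> 'rV[R]_(4 * n) -> 'rV[R]_(4 * n) -> 'rV[R]_(4 * n) -> R)
    (G : chart M -> 'rV[R]_(4 * n) -> 'rV[R]_(4 * n) -> 'rV[R]_(4 * n) ->
         'rV[R]_(4 * n))
    (J : 'I_3 -> chart M -> 'rV[R]_(4 * n) -> 'rV[R]_(4 * n) -> 'rV[R]_(4 * n)) :
  pseudo_riemannian g -> levi_civita g G -> pseudo_hyper_kahler g G J ->
  (exists S xi, [/\ homogeneous_structure g G J S, vector_field xi,
     linear_type g J S xi & strongly_degenerate g xi]) ->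
  flat G.
Proof.
move=> [[ling smoothg _] symg nondeg] [[linG smoothG _] torG parg].
move=> [[tJ skewJ sqJ J01] parJ] [S [xi [[[tS _ _] [parg' parC' parS' parJ']]]]].
move=> [smoothxi _] SE deg c x u v w cx.
have symG y a b : crange c y -> G c y a b = G c y b a.
  move=> cy; have := torG c y a b cy.
  rewrite /torsion /bracket !nabla_cst !derive_cst subrr subr0 => /eqP.
  by rewrite subr_eq0 => /eqP.
have pJ a : parallel_field (crange c) (G c) (J a c).
  by have [l s _] := tJ a; split=> [y|b|y b d]; [exact: l|exact: s|exact: parJ].
have pJ' a : parallel_field (crange c) (fun x u v => G c x u v - S c x u v) (J a c).
  by have [l s _] := tJ a; split=> [y|b|y b d]; [exact: l|exact: s|exact: parJ'].
have hh y : crange c y -> hyper_hermitian (g c y) (J 0 c y) (J 1 c y) (J 2 c y).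
  move=> cy; have [l1 l2] := ling c y cy.
  have lJ a : linear (J a c y) by have [l _ _] := tJ a; exact: l.
  exact: (HyperHermitian l2 l1 (fun a b => symg c y a b cy)
    (fun a => nondeg c y a cy) (lJ 0) (lJ 1) (lJ 2)
    (fun a b => skewJ 0 c y a b cy) (fun a b => skewJ 1 c y a b cy)
    (fun a b => skewJ 2 c y a b cy) (fun a => sqJ 0 c y a cy)
    (fun a => sqJ 1 c y a cy) (fun a => sqJ 2 c y a cy) (fun a => J01 c y a cy)).
have e0 : ord0 = 0 :> 'I_3 by exact: val_inj.
have e1 : lift ord0 ord0 = 1 :> 'I_3 by exact: val_inj.
have e2 : lift ord0 (lift ord0 ord0) = 2 :> 'I_3 by exact: val_inj.
have SEc y a b : crange c y -> S c y a b =
    linear_structure (g c y) (J 0 c y) (J 1 c y) (J 2 c y) (xi c y) a b.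
  move=> cy; rewrite SE// !big_ord_recl big_ord0 addr0 e2 e1 e0 /linear_structure.
  by congr (_ + _); exact: addrA.
have m4 : (4 < 4 * n)%N by exact: leq_trans hn.
have xi0 y : crange c y -> xi c y <> 0 by move=> cy; case: (deg c y cy).
have null y : crange c y -> g c y (xi c y) (xi c y) = 0.
  by move=> cy; case: (deg c y cy).
have linS y a : crange c y -> linear (S c y a) by move=> cy; case: (tS c y cy).
exact: (chart_flat m4 (@crd_open R _ M c) (linG c) (smoothG c) symG (ling c) (smoothg c)
  (parg c) (pJ 0) (pJ 1) (pJ 2) hh (smoothxi c) xi0 null SEc linS (parg' c)
  (pJ' 0) (pJ' 1) (pJ' 2) (parS' c) (parC' c) u v w cx).
Qed.
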